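(* $\mathrm{add}(\mathcal{N})=\min\{\mathrm{non}(\mathcal{R}),\mathfrak{b}\}$.
   Context: $\mathcal{N}$ is the ideal of Lebesgue null sets, $\mathrm{add}(\mathcal{N})$ its additivity, and $\mathfrak{b}$ the bounding number. Subsets of $\omega$ are identified with elements of $2^\omega$; a natural number $n$ is identified with $\{0,\dots,n-1\}$. For distinct $x,y\in2^\omega$ let $h(x,y)=\min\{n:x(n)\ne y(n)\}$; $H(X)=\{h(x,y):x,y\in X,x\ne y\}$. The Raisonnier filter $\mathcal{F}_X$ of $X\subseteq2^\omega$ is the set of $a\subseteq\omega$ such that there are $Y_n\subseteq 2^\omega$ ($n<\omega$) with $X\subseteq\bigcup_nY_n$ and $a\supseteq\bigcup_nH(Y_n)$. A filter $\mathcal{F}$ on $\omega$ is rapid if for every increasing $f\in\omega^\omega$ there is $a\in\mathcal{F}$ with $|a\cap f(n)|\le n$ for all $n$; the trivial filter $\mathcal{P}(\omega)$ is also considered rapid. $\mathcal{R}=\{X\subseteq2^\omega:\mathcal{F}_X\text{ is rapid}\}$, and $\mathrm{non}(\mathcal{R})$ is the least cardinality of a subset of $2^\omega$ not in $\mathcal{R}$. *)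

(* Defs.v *)
From HB Require Import structures.
From mathcomp Require Import all_boot all_order all_algebra.
From mathcomp Require Import all_classical all_reals all_analysis.

Set Implicit Arguments.
Unset Strict Implicit.
Unset Printing Implicit Defensive.

Import Order.TTheory GRing.Theory Num.Theory.
Local Open Scope classical_set_scope.
Local Open Scope card_scope.

(* A cardinal is represented by a set of that cardinality, so equality of
   cardinals is equinumerosity [#=]. The least cardinality of the members of [C]
   is represented by a member of [C] that injects into all the others; it exists
   as soon as [C] is nonempty (see [least_cardP]), the value being [set0]
   otherwise. *)
Definition least_card (T : Type) (C : set (set T)) : set T :=
  xget set0 [set A | C A /\ forall B, C B -> A #<= B].

Definition min_card (T U : Type) (A : set T) (B : set U) : set (T + U) :=
  if A #<= B then inl @` A else inr @` B.

Lemma card_least (I : Type) (T : I -> Type) : inhabited I ->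
  exists i, forall j, [set: T i] #<= [set: T j].
Proof.
move=> [i0].
pose indep (F : set (forall i, T i)) :=
  forall f g, F f -> F g -> forall i, f i = g i -> f = g.
have [F [indF maxF]] : exists F, indep F /\ forall G, F `<` G -> ~ indep G.
  apply: Zorn_bigcup => C CP totC f g [X CX Xf] [Y CY Yg].
  have [XY|YX] := totC _ _ CX CY.
    exact: (CP _ CY) (XY _ Xf) Yg.
  exact: (CP _ CX) Xf (YX _ Yg).
have [i surj] : exists i, forall t : T i, exists2 f, F f & f i = t.
  apply: contrapT => /forallNP nsurj.
  have [x xP] : exists x : forall i, T i, forall i f, F f -> f i <> x i.
    suff /all_sig[x xP] : forall i, {t : T i | forall f, F f -> f i <> t}.
      by exists x.
    move=> i; apply: cid; have /existsNP[t tP] := nsurj i.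
    by exists t => f Ff fit; apply: tP; exists f.
  apply: (maxF (F `|` [set x])).
    split=> [f Ff|sub]; first by left.
    by have /xP/(_ erefl) := sub x (or_intror erefl); apply.
  move=> f g [Ff|->] [Fg|->] i //.
  - exact: indF.
  - by move=> /(xP _ _ Ff).
  - by move=> /esym/(xP _ _ Fg).
exists i => j.
have /choice[s sP] : forall t : T i, exists f, F f /\ f i = t.
  by move=> t; have [f ? ?] := surj t; exists f.
have sinj : injective (fun t => s t j).
  move=> t u stu; rewrite -(sP t).2 -(sP u).2.
  by rewrite (indF _ _ (sP t).1 (sP u).1 _ stu).
have im_eq : (fun t => s t j) @` [set: T i] #= [set: T i].
  by apply: inj_card_eq => t u _ _; exact: sinj.
by rewrite -(card_le_eql im_eq); exact: card_leT.
Qed.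

Lemma least_cardP (T : Type) (C : set (set T)) : C !=set0 ->
  C (least_card C) /\ forall B, C B -> least_card C #<= B.
Proof.
move=> [A0 CA0]; rewrite /least_card.
have [[A CA] leA] := card_least (fun i : {A | C A} => set_type (sval i))
  (inhabits (exist _ A0 CA0)).
case: xgetP => [A' _ //|/(_ A) []]; split=> // B CB.
have := leA (exist _ B CB); rewrite /= (card_le_eql (card_setT A)).
by rewrite (card_le_eqr (card_setT B)).
Qed.

Definition lebesgue_null (R : realType) : set (set R) :=
  [set A | (@lebesgue_measure R).-negligible A].

Definition add_null (R : realType) : set (set R) :=
  least_card [set F : set (set R) | F `<=` @lebesgue_null R /\
                                    ~ lebesgue_null (\bigcup_(A in F) A)].

Arguments add_null : clear implicits.

Definition eventually_le (f g : nat -> nat) : Prop :=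
  \forall n \near \oo, (f n <= g n)%N.

Definition bounding_number : set (nat -> nat) :=
  least_card [set F | ~ exists g, forall f, F f -> eventually_le f g].

Lemma neq_exists_diff (x y : nat -> bool) : x <> y -> exists n, x n != y n.
Proof.
move=> xy; apply: contrapT => /forallNP eqxy; apply: xy; apply/funext => n.
by apply/eqP; have /negP := eqxy n; rewrite negbK.
Qed.

Definition first_diff (x y : nat -> bool) (xy : x <> y) : nat :=
  ex_minn (neq_exists_diff xy).

Definition first_diffs (X : set (nat -> bool)) : set nat :=
  [set n | exists (x y : nat -> bool) (xy : x <> y),
             [/\ X x, X y & n = first_diff xy]].

Definition raisonnier (X : set (nat -> bool)) : set (set nat) :=
  [set a | exists Y : nat -> set (nat -> bool),
             X `<=` \bigcup_n Y n /\ \bigcup_n first_diffs (Y n) `<=` a].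

Lemma first_diffsS (X Y : set (nat -> bool)) :
  X `<=` Y -> first_diffs X `<=` first_diffs Y.
Proof.
by move=> XY n [x [y [xy [Xx Xy ->]]]]; exists x, y, xy; split=> //; exact: XY.
Qed.

Lemma raisonnier_filter (X : set (nat -> bool)) : Filter (raisonnier X).
Proof.
split.
- by exists (fun=> X); split=> // x Xx; exists 0%N.
- move=> a b [Y [XY Ya]] [Z [XZ Zb]].
  pose W n := if unpickle n is Some p then Y p.1 `&` Z p.2 else set0.
  exists W; split=> [x Xx|n [k _]].
    have [i _ Yx] := XY _ Xx; have [j _ Zx] := XZ _ Xx.
    by exists (pickle (i, j)) => //; rewrite /W pickleK.
  rewrite /W; case: unpickle => [[i j]/=|[x [y [xy []]]] //] ijn.
  split.
    by apply: Ya; exists i => //; apply: first_diffsS ijn; exact: subIsetl.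
  by apply: Zb; exists j => //; apply: first_diffsS ijn; exact: subIsetr.
- move=> a b ab [Y [XY Ya]]; exists Y; split=> //.
  exact: subset_trans ab.
Qed.

(* The improper filter [setT] is rapid, as witnessed by [a = set0]. *)
Definition rapid (F : set (set nat)) : Prop :=
  forall f : nat -> nat, {homo f : m n / (m < n)%N} ->
    exists2 a, F a & forall n, a `&` `I_(f n) #<= `I_n.

Definition rapid_raisonnier : set (set (nat -> bool)) :=
  [set X | rapid (raisonnier X)].

Definition non_rapid_raisonnier : set (nat -> bool) :=
  least_card (~` rapid_raisonnier).

(* Main.v *)
(* Both inequalities go through Bartoszynski's localization by slaloms.

   [add(N) <= non(R), b]: to [f : nat -> nat] attach the null set [H_f] of the
   reals lying in infinitely many of the sets [G_(n, f n)], where for fixed [n]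
   the [G_(n, m)] are independent of measure [2^-n]. If the union of the [H_f] is
   null, it misses a closed set of positive measure, and by Baire category in that
   set each [f n] is eventually confined to the set of those [m] for which
   [G_(n, m)] misses a fixed piece of positive measure; independence bounds the
   number of such [m]. There are countably many pieces, so all the [f] are captured
   by one slalom. A captured family is bounded, and if the maps [n |-> x|k_n] for
   [x] in [X] are captured with [k] growing fast, then the places in
   [[k_n, k_(n+1)[] where two members of the slalom at [n+1] first differ form a
   set in the Raisonnier filter of [X] that is as sparse as required.

   [add(N) >= min(non(R), b)]: let [F] be bounded by [G] and let the graphs of its
   members form a set in [R]. If [a] is a sparse member of the Raisonnier filter,
   witnessed by [Y_i], then a member of [Y_i] is determined below [K n] by its
   values on the at most [n] elements of [a] below [K n], so there are at most
   [2^n] possible values of [f n] for graphs in [Y_i]: [F] is captured by a slalom.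
   Applied to codes of covers of null sets by sets of prescribed small measure,
   this covers all of them by one null set. *)
From mathcomp Require Import all_boot all_order all_algebra.
From mathcomp Require Import all_classical all_reals all_analysis.
From mathcomp Require Import zify ring lra.
(* Last, because mathcomp-analysis has another [first_diff]. *)
Require Import Defs.

Set Implicit Arguments.
Unset Strict Implicit.
Unset Printing Implicit Defensive.

Import Order.TTheory GRing.Theory Num.Theory.
Local Open Scope classical_set_scope.
Local Open Scope card_scope.
Import numFieldNormedType.Exports.

(** * Slaloms and the Raisonnier filter *)

Definition localized (h : nat -> nat) (F : set (nat -> nat)) : Prop :=
  exists2 S : nat -> seq nat, forall n, (size (S n) <= h n)%N &
    forall f, F f -> \forall n \near \oo, f n \in S n.

Lemma seq_card_le (A : set nat) (s : seq nat) (n : nat) :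
  A `<=` [set` s] -> (size s <= n)%N -> A #<= `I_n.
Proof.
move=> As sn; apply: (card_le_trans (subset_card_le As)).
apply/pcard_surjP; exists (nth 0%N s) => x /= xs; exists (index x s).
  by rewrite /=; apply: leq_trans sn; rewrite index_mem.
exact: nth_index.
Qed.

Lemma card_le_seq (A : set nat) (n : nat) : A #<= `I_n ->
  exists2 s : seq nat, size s = n & A `<=` [set` s].
Proof.
move=> /pcard_surjP[g gA]; exists (mkseq g n); first exact: size_mkseq.
move=> x /gA[i /= ilt <-]; apply/mapP; exists i => //.
by rewrite mem_iota.
Qed.

Lemma localized_bounded h F : localized h F ->
  exists g, forall f, F f -> eventually_le f g.
Proof.
move=> [S _ SF]; exists (fun n => \max_(m <- S n) m) => f /SF.
apply: filterS => n fS; exact: (@leq_bigmax_seq _ _ predT id).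
Qed.

Lemma first_diff_neq x y (xy : x <> y) : x (first_diff xy) != y (first_diff xy).
Proof. by rewrite /first_diff; case: ex_minnP. Qed.

Lemma first_diff_eq x y (xy : x <> y) p :
  (p < first_diff xy)%N -> x p = y p.
Proof.
rewrite /first_diff; case: ex_minnP => m _ min_m pm; apply/eqP.
by apply: contraTT pm => /min_m; rewrite -leqNgt.
Qed.

(** A version of [first_diff] on finite words, total so that it can be mapped over all pairs of
    words in a slalom. *)
Definition list_diff (uv : seq bool * seq bool) : nat :=
  find (fun i => nth false uv.1 i != nth false uv.2 i) (iota 0 (size uv.1)).

Lemma list_diff_mkseq x y (xy : x <> y) k : (first_diff xy < k)%N ->
  list_diff (mkseq x k, mkseq y k) = first_diff xy.
Proof.
move=> pk; rewrite /list_diff /= size_mkseq.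
set P := (X in find X _); set p := first_diff xy in pk *.
have PE i : (i < k)%N -> P i = (x i != y i) by move=> ik; rewrite /P !nth_mkseq.
have hasP : has P (iota 0 k).
  by apply/hasP; exists p; rewrite ?mem_iota// PE// first_diff_neq.
have lt_k : (find P (iota 0 k) < k)%N by rewrite -{2}(size_iota 0 k) -has_find.
have := nth_find 0%N hasP; rewrite nth_iota// PE// add0n => neq.
apply/eqP; rewrite eqn_leq; apply/andP; split; last first.
  by rewrite leqNgt; apply/negP => /first_diff_eq /eqP; apply/negP.
rewrite leqNgt; apply/negP => /(before_find 0%N).
by rewrite nth_iota ?size_iota// add0n PE// first_diff_neq.
Qed.

(** The last index counted satisfies the threshold condition, and its partial sum dominates all the
    terms counted. *)
Lemma sum_below_threshold (b : nat -> nat) t M :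
  (\sum_(j < M | \sum_(i < j.+1) (b i).+1 < t) b j <= t)%N.
Proof.
elim: M => [|M IH]; first by rewrite big_ord0.
rewrite big_mkcond big_ord_recr /= -big_mkcond /=;
case: ifPn => [lt_t|_]; last by rewrite addn0.
apply: leq_trans (ltnW lt_t); rewrite big_ord_recr /= leq_add//.
by rewrite big_mkcond leq_sum// => i _; case: ifP.
Qed.

Definition restriction_code (k : nat -> nat) (x : nat -> bool) (n : nat) : nat :=
  pickle (mkseq x (k n)).

Definition unpickled_pairs (s : seq nat) : seq (seq bool * seq bool) :=
  let t := pmap unpickle s in [seq (u, v) | u <- t, v <- t].

Lemma size_unpickled_pairs s : (size (unpickled_pairs s) <= size s ^ 2)%N.
Proof.
rewrite size_allpairs -mulnn leq_mul// size_pmap -!count_predT; exact: sub_count.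
Qed.

Lemma rapid_of_localized h (X : set (nat -> bool)) :
  (forall k, {homo k : m n / (m < n)%N} ->
    localized h (restriction_code k @` X)) -> rapid_raisonnier X.
Proof.
(* [b j] bounds the number of first differences read off the slalom at [j.+1]. A stage with [k j]
   below [f t] has [q j] below [t], so [sum_below_threshold] leaves at most [t] elements. *)
move=> locX f fincr; pose b j := (h j.+1 ^ 2)%N.
pose q j := (\sum_(i < j.+1) (b i).+1)%N; pose k j := f (q j).
have fmono : {mono f : m n / (m <= n)%N} by apply: leq_mono.
have qincr : {homo q : m n / (m < n)%N}.
  apply: homo_ltn; first exact: ltn_trans.
  by move=> i; rewrite /q [ltnRHS]big_ord_recr /= addnS ltnS leq_addr.
have kincr : {homo k : m n / (m < n)%N} by move=> m n mn; apply/fincr/qincr.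
have [S hS SX] := locX _ kincr.
pose D n := [seq list_diff uv | uv <- unpickled_pairs (S n)].
pose a := [set p | exists j, [/\ (k j <= p)%N, (p < k j.+1)%N & p \in D j.+1]].
have sizeD j : (size (D j.+1) <= b j)%N.
  by rewrite size_map (leq_trans (size_unpickled_pairs _))// leq_sqr.
exists a.
(* A piece fixes a place [N] of capture and the word below [k N], so its members first differ at or
   after [k N], where the slalom captures both. *)
- pose Y c := if unpickle c is Some (N, s) then
    [set x | mkseq x (k N) = s /\
      forall n, (N <= n)%N -> restriction_code k x n \in S n] else set0.
  exists Y; split=> [x Xx|p [c _]].
    have [N _ SN] := SX _ (ex_intro2 _ _ x Xx erefl).
    by exists (pickle (N, mkseq x (k N))) => //; rewrite /Y pickleK; split.
  rewrite /Y; case: unpickle => [[N s]|[? [? [? []]]]//].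
  move=> [x [y [xy [[xs xS] [ys yS] ->]]]].
  have kN : (k N <= first_diff xy)%N.
    rewrite leqNgt; apply/negP => lt.
    have := first_diff_neq xy; rewrite -(nth_mkseq false x lt) -(nth_mkseq false y lt).
    by rewrite xs ys eqxx.
  have ex : exists n, (first_diff xy < k n)%N.
    exists (first_diff xy).+1; have : {homo k : m n / (m < n)%N} := kincr.
    by move=> /leq_mono kmono; elim: (first_diff xy) => [|m IH];
      [have := kincr 0%N 1%N|have := kincr m.+1 m.+2]; lia.
  have [[|n] ltn minn] := ex_minnP ex.
    by have := leq_mono kincr 0%N N; lia.
  have Nn : (N <= n)%N.
    by rewrite -ltnS ltnNge; apply/negP => /=; rewrite -(leq_mono kincr); lia.
  exists n; split => //.
    by rewrite leqNgt; apply/negP => /minn; rewrite ltnn.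
  rewrite -(list_diff_mkseq ltn); apply/map_f/allpairs_f.
    rewrite mem_pmap; apply/mapP; exists (restriction_code k x n.+1).
      by apply: xS; lia.
    by rewrite pickleK.
  rewrite mem_pmap; apply/mapP; exists (restriction_code k y n.+1).
    by apply: yS; lia.
  by rewrite pickleK.
- move=> t; apply: (@seq_card_le _ (flatten [seq D j.+1 | j <- iota 0 t & (q j < t)%N])).
    move=> p [[j [kp pk pD]] /= pf]; apply/flatten_mapP; exists j => //.
    have qt : (q j < t)%N.
      by rewrite ltnNge -fmono -ltnNge; apply: leq_ltn_trans pf.
    rewrite mem_filter qt mem_iota /= add0n; apply: leq_ltn_trans qt.
    by elim: (j) => [//|i IH]; apply: (leq_ltn_trans IH); apply: qincr.
  rewrite size_flatten /shape -map_comp sumnE big_map big_filter.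
  apply: leq_trans (sum_below_threshold b t t).
  have -> : iota 0 t = index_iota 0 t by rewrite /index_iota subn0.
  rewrite big_mkord.
  by apply: leq_sum => j _; exact: sizeD.
Qed.

Definition graph_code (f : nat -> nat) (p : nat) : bool :=
  if unpickle p is Some (n, m) then f n == m else false.

Lemma localized_of_rapid G (F : set (nat -> nat)) :
  (forall f, F f -> eventually_le f G) -> rapid_raisonnier (graph_code @` F) ->
  localized (fun n => n.+1 * 2 ^ n)%N F.
Proof.
move=> FG rapF.
(* [K n] exceeds the codes of all pairs [(j, m)] with [j <= n] and [m <= G j], so a graph read below
   [K n] determines a value at [n] that is at most [G n]. The successor makes [K] strictly
   increasing. *)
pose K n := (\sum_(j < n.+1) \sum_(m < (G j).+1) (pickle (j : nat, m : nat)).+1)%N.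
have Kincr : {homo K : m n / (m < n)%N}.
  apply: homo_ltn; first exact: ltn_trans.
  by move=> i; rewrite /K [ltnRHS]big_ord_recr /= -[ltnLHS]addn0 ltn_add2l big_ord_recl.
have ltK n m : (m <= G n)%N -> (pickle (n, m) < K n)%N.
  move=> mG; rewrite /K big_ord_recr /= -ltnS in mG *.
  rewrite (bigD1 (Ordinal mG)) //= addnCA addSn ltnS; exact: leq_addr.
have [a [Y [FY Ya]] acard] := rapF _ Kincr.
have /choice[e eP] : forall n, exists s : seq nat,
    size s = n /\ a `&` `I_(K n) `<=` [set` s].
  by move=> n; have [s ? ?] := card_le_seq (acard n); exists s.
(* Two graphs in one [Y i] with the same word at [n] agree below [K n]: a first difference there
   would be in [a], hence listed in [e n]. So [pick] recovers the value at [n] from the word. *)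
pose word n (x : nat -> bool) : n.-tuple bool := [tuple x (nth 0%N (e n) i) | i < n].
pose good i n (w : n.-tuple bool) f :=
  [/\ F f, (f n <= G n)%N, Y i (graph_code f) & word n (graph_code f) = w].
pose pick i n w := xget (fun=> 0%N) [set f | good i n w f] n.
have pickP i n f : F f -> (f n <= G n)%N -> Y i (graph_code f) ->
    pick i n (word n (graph_code f)) = f n.
  move=> Ff fG Yf; rewrite /pick; case: xgetP => [g _ [Fg gG Yg wg]|/(_ f) []//].
  have agree p : (p < K n)%N -> graph_code f p = graph_code g p.
    have [->//|/eqP fg] := eqVneq (graph_code f) (graph_code g).
    move=> pK; have [pd|dp] := ltnP p (first_diff fg); first exact: first_diff_eq pd.
    have da : (a `&` `I_(K n)) (first_diff fg).
      split; last exact: leq_ltn_trans pK.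
      by apply: Ya; exists i => //; exists (graph_code f), (graph_code g), fg.
    have [se /(_ _ da) /= de] := eP n.
    have lt : (index (first_diff fg) (e n) < n)%N by rewrite -{2}se index_mem.
    have := congr1 (fun t : n.-tuple bool => tnth t (Ordinal lt)) wg.
    rewrite !tnth_mktuple /= nth_index// => /esym/eqP.
    by rewrite (negbTE (first_diff_neq fg)).
  have := agree _ (ltK _ _ fG); rewrite /graph_code pickleK eqxx.
  by move=> /esym/eqP.
(* At [n] only the [Y i] with [i <= n] are served; a member of [Y i] is captured from [i] on, once
   it is also below [G]. *)
exists (fun n => [seq pick i n w | i <- iota 0 n.+1, w <- enum {: n.-tuple bool}]).
  by move=> n; rewrite size_allpairs size_iota -cardT card_tuple card_bool.
move=> f Ff; have [i _ Yi] := FY _ (ex_intro2 _ _ f Ff erefl).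
near=> n; have fG : (f n <= G n)%N by near: n; exact: FG.
rewrite -(pickP i n f)//; apply: allpairs_f; last by rewrite mem_enum.
rewrite mem_iota add0n ltnS /=; near: n; exact: nbhs_infty_ge.
Unshelve. all: by end_near.
Qed.

(** A slalom of width [G n] omits one of the [(G n).+1] values up to [G n], so the functions below
    [G] are not captured. This lets [least_cardP] apply to [non_rapid_raisonnier]. *)
Lemma exists_non_rapid : ~` rapid_raisonnier !=set0.
Proof.
pose G n := (n.+1 * 2 ^ n)%N; pose F := [set f | forall n, (f n <= G n)%N].
exists (graph_code @` F) => /(localized_of_rapid (G := G)) [].
  by move=> f Ff; apply: nearW => n; exact: Ff.
move=> S hS SF.
have /choice[f fP] : forall n, exists m, (m <= G n)%N /\ m \notin S n.
  move=> n; have [|] := boolP (all (mem (S n)) (iota 0 (G n).+1)).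
    move=> /allP sub; have := uniq_leq_size (iota_uniq 0 (G n).+1) sub.
    by rewrite size_iota => /leq_trans/(_ (hS n)); rewrite ltnn.
  by rewrite -has_predC => /hasP[m]; rewrite mem_iota => mG mS; exists m.
have [N _ /(_ N (leqnn N)) /=] := SF f (fun n => (fP n).1).
by rewrite (negbTE (fP N).2).
Qed.

Lemma exists_unbounded :
  [set F : set (nat -> nat) |
    ~ exists g, forall f, F f -> eventually_le f g] !=set0.
Proof.
exists setT => -[g /(_ (fun n => (g n).+1) I)] [N _ /(_ N (leqnn N))] /=.
by rewrite ltnn.
Qed.

(** * Comparison of cardinals *)

Lemma card_le_total (T U : Type) (A : set T) (B : set U) : A #<= B \/ B #<= A.
Proof.
have [b bP] := card_least (fun b : bool => if b then set_type A else set_type B)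
  (inhabits true).
have := bP (~~ b); case: b {bP} => /=;
  rewrite (card_le_eql (card_setT _)) (card_le_eqr (card_setT _)); by [left|right].
Qed.

Lemma min_card_le (T U V : Type) (A : set T) (B : set U) (C : set V) :
  min_card A B #<= C <-> A #<= C \/ B #<= C.
Proof.
rewrite /min_card; case: ifPn => AB; split.
- by rewrite (card_le_eql (inj_card_eq _)); [left|move=> ? ? _ _ []].
- rewrite (card_le_eql (inj_card_eq _)); last by move=> ? ? _ _ [].
  by case=> // BC; exact: card_le_trans AB BC.
- by rewrite (card_le_eql (inj_card_eq _)); [right|move=> ? ? _ _ []].
- rewrite (card_le_eql (inj_card_eq _)); last by move=> ? ? _ _ [].
  case=> // AC; have [|BA] := card_le_total A B; first by rewrite (negbTE AB).
  exact: card_le_trans BA AC.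
Qed.

Lemma le_min_card (T U V : Type) (A : set T) (B : set U) (C : set V) :
  C #<= A -> C #<= B -> C #<= min_card A B.
Proof.
by move=> CA CB; rewrite /min_card; case: ifPn => _;
  rewrite (card_le_eqr (inj_card_eq _)) // => ? ? _ _ [].
Qed.

(** * From slaloms to null sets *)

Local Open Scope ring_scope.

Lemma bigcup_seq_cons (I : eqType) (T : Type) (D : I -> set T) a s :
  \bigcup_(c in [set` a :: s]) D c = D a `|` \bigcup_(c in [set` s]) D c.
Proof.
rewrite -bigcup_setU1; congr bigcup; apply/seteqP.
by split=> x /=; rewrite inE => /predU1P.
Qed.

Lemma bigcup_seq_nil (I : eqType) (T : Type) (D : I -> set T) :
  \bigcup_(c in [set` [::]]) D c = set0.
Proof. by apply/seteqP; split=> // x [c]. Qed.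

Lemma measurable_bigcup_seq d (T : measurableType d) (I : eqType)
    (D : I -> set T) (s : seq I) :
  (forall c, measurable (D c)) -> measurable (\bigcup_(c in [set` s]) D c).
Proof.
move=> mD; elim: s => [|a s IH]; first by rewrite bigcup_seq_nil.
by rewrite bigcup_seq_cons; exact: measurableU.
Qed.

Lemma measure_bigcup_seq_le d (T : measurableType d) (R : realType)
    (mu : measure T R) (I : eqType) (D : I -> set T) (s : seq I) :
  (forall c, measurable (D c)) ->
  (mu (\bigcup_(c in [set` s]) D c) <= \sum_(c <- s) mu (D c))%E.
Proof.
move=> mD; elim: s => [|a s IH].
  by rewrite bigcup_seq_nil measure0 big_nil.
rewrite bigcup_seq_cons big_cons (le_trans (measureU2 _ _ _))//.
  exact: measurable_bigcup_seq.
by rewrite leeD2l.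
Qed.

Definition rat_itv (R : realType) (k : nat) : set R :=
  if unpickle k is Some qr
  then [set` `](ratr qr.1 : R), (ratr qr.2 : R)[] else set0.

Arguments rat_itv : clear implicits.

Lemma measurable_rat_itv (R : realType) k : measurable (rat_itv R k).
Proof. by rewrite /rat_itv; case: (unpickle k) => [qr|]. Qed.

Lemma open_rat_itv (R : realType) (U : set R) (x : R) : open U -> U x ->
  exists2 k, rat_itv R k `<=` U & rat_itv R k x.
Proof.
move=> oU Ux; have /nbhs_ballP[e /= e0 xeU] : nbhs x U.
  by apply: open_nbhs_nbhs; split.
have [|q] := @rat_in_itvoo R (x - e) x; first by rewrite ltrBlDr ltrDl.
have [|r] := @rat_in_itvoo R x (x + e); first by rewrite ltrDl.
rewrite !in_itv /= => /andP[xr re] /andP[eq qx].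
exists (pickle (q, r)); rewrite /rat_itv pickleK /=; last first.
  by rewrite in_itv /= qx xr.
move=> y; rewrite /= in_itv /= => /andP[qy yr]; apply: xeU.
by rewrite ball_itv /= in_itv /= (lt_trans eq qy) (lt_trans yr re).
Qed.

(** Differences are allowed in order to express the pieces between successive finite unions inside
    an open set; the codes remain countable. *)
Definition simple_set (R : realType) (c : seq nat * seq nat) : set R :=
  \bigcup_(k in [set` c.1]) rat_itv R k `\` \bigcup_(k in [set` c.2]) rat_itv R k.
Arguments simple_set : clear implicits.

Lemma measurable_simple_set (R : realType) c : measurable (simple_set R c).
Proof.
by apply: measurableD; apply: measurable_bigcup_seq => k; exact: measurable_rat_itv.
Qed.

Lemma lebesgue_null_open (R : realType) (A : set R) (e : R) : 0 < e ->
  lebesgue_null A -> exists U : set R,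
    [/\ open U, A `<=` U & (lebesgue_measure U < e%:E)%E].
Proof.
move=> e0 [B [mB muB AB]].
have Boo : (@lebesgue_measure R B < +oo)%E by rewrite muB.
have [U [oU BU Ue]] := lebesgue_regularity_outer mB Boo e0.
have mU : measurable (U : set (measurableTypeR R)) by
  exact: measurable_realfun.open_measurable.
exists U; split=> //; first exact: subset_trans BU.
rewrite -(setDUK BU); apply: le_lt_trans (measureU2 _ _ _) _ => //.
  exact: measurableD.
by rewrite [X in (X + _)%E](_ : _ = 0%E)// add0e.
Qed.

Lemma le_lebesgue (R : realType) (A B : set (measurableTypeR R)) :
  measurable A -> measurable B -> A `<=` B ->
  (lebesgue_measure A <= lebesgue_measure B)%E.
Proof. by move=> mA mB; apply: le_measure; rewrite inE. Qed.

(** An open set around [B] is exhausted by finite unions [E i] of rational intervals; the piece of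
    index [n] lies in what [E (p n)] leaves of it, which can be made small. *)
Lemma lebesgue_null_cover (R : realType) (B : set R) (delta : nat -> R) :
  lebesgue_null B -> (forall n, 0 < delta n) ->
  exists2 c : nat -> seq nat * seq nat,
    forall n, (lebesgue_measure (simple_set R (c n)) <= (delta n)%:E)%E &
    B `<=` \bigcup_n simple_set R (c n).
Proof.
move=> B0 dpos; have [U [oU BU Ud]] := lebesgue_null_open (dpos 0%N) B0.
have mU : measurable (U : set (measurableTypeR R)) by
  exact: measurable_realfun.open_measurable.
pose L i := [seq k <- iota 0 i | `[< rat_itv R k `<=` U >]].
pose E i : set (measurableTypeR R) := \bigcup_(k in [set` L i]) rat_itv R k.
have mE i : measurable (E i).
  by apply: measurable_bigcup_seq => k; exact: measurable_rat_itv.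
have LP i k : (k \in L i) = (k < i)%N && `[< rat_itv R k `<=` U >].
  by rewrite mem_filter mem_iota andbC.
have EU i : E i `<=` U.
  by move=> x [k /=]; rewrite LP => /andP[_ /asboolP]; apply.
have E0 : E 0%N = set0 by rewrite /E bigcup_seq_nil.
have ndE i j : (i <= j)%N -> E i `<=` E j.
  move=> ij; apply: bigcup_subset => k /=; rewrite !LP => /andP[ki ->].
  by rewrite (leq_trans ki ij).
have UE x : U x -> exists i, E i x.
  move=> /(open_rat_itv oU)[k kU kx]; exists k.+1; exists k => //=.
  by rewrite LP ltnSn /=; apply/asboolP.
have cvg0 : (@lebesgue_measure R (U `\` E i)) @[i --> \oo] --> 0%E.
  rewrite -(measure0 (@lebesgue_measure R)).
  have -> : set0 = \bigcap_i (U `\` E i).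
    apply/esym/seteqP; split=> // x xUE; have [Ux _] := xUE 0%N I.
    by have [i Eix] := UE x Ux; have [_] := xUE i I.
  apply: nonincreasing_cvg_mu => //.
  - rewrite E0 setD0; apply: lt_trans Ud _; exact: ltry.
  - by move=> i; exact: measurableD.
  - by apply: bigcapT_measurable => i; exact: measurableD.
  - by move=> i j ij; apply/subsetPset; apply: setDS; exact: ndE.
(* [p 0 = 0] starts from the empty union, where the measure of [U] itself gives the bound;
   [n <= p n] makes the [E (p n)] exhaust [U]. *)
have /choice[p pP] : forall n, exists p, [/\ (n <= p)%N, n = 0%N -> p = 0%N &
    (@lebesgue_measure R (U `\` E p) <= (delta n)%:E)%E].
  case=> [|n]; first by exists 0%N; split=> //; rewrite E0 setD0 ltW.
  have /cvg0[N _ NP] : nbhs (0%E : \bar R) [set y | (y < (delta n.+1)%:E)%E].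
    by apply: open_nbhs_nbhs; split; [exact: open_ereal_lt_ereal|rewrite /= lte_fin].
  exists (maxn n.+1 N); split=> //; first exact: leq_maxl.
  by apply/ltW/NP; exact: leq_maxr.
exists (fun n => (L (p n.+1), L (p n))) => [n|x /BU/UE[i Eix]].
  have [_ _] := pP n; apply: le_trans; apply: le_lebesgue.
  - exact: measurable_simple_set.
  - exact: measurableD.
  - by apply: setSD; exact: EU.
have ex : exists n, `[< E (p n) x >].
  by exists i; apply/asboolP; have [ip _ _] := pP i; exact: ndE Eix.
have [[|n] /asboolP Ex minn] := ex_minnP ex.
  by have [_ /(_ erefl) p0 _] := pP 0%N; move: Ex; rewrite p0 E0.
exists n => //; split=> // Enx; have := minn n (asboolT Enx).
by rewrite ltnn.
Qed.

(** Finitely many codes lie below [M]. Hence a slalom that captures from [M] on captures whole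
    covers from some index [N] on. *)
Lemma pickle_pair_ge (M : nat) : exists N, forall j n : nat,
  (N <= j)%N -> (M <= pickle (j, n))%N.
Proof.
exists (\max_(m < M) odflt 0%N (omap (fun jn : nat * nat => jn.1) (unpickle m))).+1.
move=> j n; apply: contraLR; rewrite -!ltnNge ltnS => lt.
by have := leq_bigmax (Ordinal lt)
  (F := fun m : 'I_M => odflt 0%N (omap (fun jn : nat * nat => jn.1) (unpickle m)));
  rewrite /= pickleK.
Qed.

Lemma null_bigcup_of_localized (R : realType) h (C : set (set R)) :
  C `<=` @lebesgue_null R ->
  (forall g : set R -> nat -> nat, localized h (g @` C)) ->
  lebesgue_null (\bigcup_(A in C) A).
Proof.
(* Up to [h] sets at the code of [(j, n)] have total measure at most [2^-(n+1) / (j+1)], which sums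
   over [n] to at most [1 / (j+1)]. The successor of [h] keeps [delta] positive where [h]
   vanishes. *)
move=> C0 locC; pose delta j n : R :=
  (j.+1%:R^-1 / (2 ^ n.+1)%:R) / (h (pickle (j, n))).+1%:R.
have dpos j n : 0 < delta j n by rewrite !divr_gt0// ltr0n expn_gt0.
have /choice[c cP] : forall A, exists c : nat -> nat -> seq nat * seq nat, C A ->
    forall j, (forall n, (lebesgue_measure (simple_set R (c j n)) <= (delta j n)%:E)%E)
      /\ A `<=` \bigcup_n simple_set R (c j n).
  move=> A; have [CA|nCA] := pselect (C A); last by exists (fun _ _ => ([::], [::])).
  have /choice[c cP] : forall j, exists c : nat -> seq nat * seq nat,
      (forall n, (lebesgue_measure (simple_set R (c n)) <= (delta j n)%:E)%E)
      /\ A `<=` \bigcup_n simple_set R (c n).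
    by move=> j; have [c ? ?] := lebesgue_null_cover (C0 _ CA) (dpos j); exists c.
  by exists c.
have [S hS SC] := locC (fun A m =>
  if unpickle m is Some jn then pickle (c A jn.1 jn.2) else 0%N).
(* The slalom may also contain codes of large sets; these are discarded. *)
pose T j n := [seq d <- pmap unpickle (S (pickle (j, n))) |
  (lebesgue_measure (simple_set R d) <= (delta j n)%:E)%E].
pose V j : set (measurableTypeR R) :=
  \bigcup_n \bigcup_(d in [set` T j n]) simple_set R d.
have mT j n : measurable (\bigcup_(d in [set` T j n]) simple_set R d :
    set (measurableTypeR R)).
  by apply: measurable_bigcup_seq => d; exact: measurable_simple_set.
have mV j : measurable (V j) by apply: bigcupT_measurable => n; exact: mT.
have leV j : (lebesgue_measure (V j) <= (j.+1%:R^-1)%:E)%E.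
  apply: (le_trans (measure_sigma_subadditive _ (mT j) (mV j) (@subset_refl _ _))).
  have j0 : 0 <= j.+1%:R^-1 :> R by rewrite invr_ge0 ler0n.
  apply: le_trans (epsilon_trick0 xpredT j0).
  apply: lee_nneseries => // n _.
  apply: (le_trans (measure_bigcup_seq_le (@lebesgue_measure R) (T j n)
    (@measurable_simple_set R))).
  apply: (@le_trans _ _ (\sum_(d <- T j n) (delta j n)%:E)%E).
    by rewrite !big_seq; apply: lee_sum => d; rewrite mem_filter => /andP[].
  rewrite sumEFin lee_fin big_const_seq count_predT iter_addr addr0.
  rewrite -[_ *+ size _]mulr_natr /delta -[leLHS]mulrA ler_piMr//.
  rewrite mulrC ler_pdivrMr ?ltr0n// mul1r ler_nat.
  apply: leq_trans (leqnSn _); apply: leq_trans (hS _).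
  by rewrite size_filter (leq_trans (count_size _ _))// size_pmap count_size.
(* Capture holds only from some place on, so a member of [C] is known to lie in [V j] only for large
   [j]. *)
pose W N : set (measurableTypeR R) := \bigcap_(j in [set j | (N <= j)%N]) V j.
have nullW N : (@lebesgue_measure R).-negligible (W N).
  have mW : measurable (W N) by apply: bigcap_measurableType => j _.
  apply/negligibleP => //; apply/eqP; rewrite eq_le measure_ge0 andbT.
  apply/lee_addgt0Pr => e e0; rewrite add0e.
  have [n _ /(_ (maxn n N) (leq_maxl _ _)) ne] := near_infty_natSinv_lt (PosNum e0).
  apply: (@le_trans _ _ (lebesgue_measure (V (maxn n N)))).
    by apply: le_lebesgue => //; apply: bigcap_inf; exact: leq_maxr.
  by apply: (le_trans (leV _)); rewrite lee_fin ltW.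
apply: negligibleS (negligible_bigcup nullW) => x [A CA Ax].
have [M _ MS] := SC _ (ex_intro2 _ _ A CA erefl).
have [N NM] := pickle_pair_ge M; exists N => // j /= /NM Nj.
have [le_d /(_ x Ax)[n _ xn]] := cP A CA j; exists n => //.
exists (c A j n) => //=; rewrite mem_filter le_d /= mem_pmap.
apply/mapP; exists (pickle (c A j n)); last by rewrite pickleK.
by have := MS _ (Nj n); rewrite /= pickleK.
Qed.

(** * From null sets to slaloms *)

Lemma near_exp2V_lt (R : realType) (e : R) : 0 < e ->
  \forall n \near \oo, (2 ^+ n)^-1 < e.
Proof.
move=> e0; under eq_near do rewrite -exprVn.
have : (2^-1 : R) ^+ n @[n --> \oo] --> (0 : R).
  by apply: cvg_expr; rewrite ger0_norm ?invf_lt1// ?ltr1n// invr_ge0.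
by move=> /cvgr_lt/(_ e e0).
Qed.

Definition dyadic (R : realType) (l k : nat) : set R :=
  [set x | k%:R <= x * 2 ^+ l < k.+1%:R].
Arguments dyadic : clear implicits.

Lemma dyadicE (R : realType) l k :
  dyadic R l k = [set` `[k%:R / 2 ^+ l, k.+1%:R / 2 ^+ l[].
Proof.
apply/seteqP; split=> x /=; rewrite in_itv /= ler_pdivrMr ?exprn_gt0//;
  by rewrite ltr_pdivlMr ?exprn_gt0.
Qed.

Lemma measurable_dyadic (R : realType) l k :
  measurable (dyadic R l k : set (measurableTypeR R)).
Proof. by rewrite dyadicE. Qed.

Lemma lebesgue_dyadic (R : realType) l k :
  lebesgue_measure (dyadic R l k) = ((2 ^+ l)^-1)%:E.
Proof.
rewrite dyadicE lebesgue_measure_itv /= lte_fin ltr_pM2r ?invr_gt0 ?exprn_gt0//.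
by rewrite ltr_nat ltnSn -EFinB -mulrBl -natrB// subSnn mul1r.
Qed.

Lemma dyadic_split (R : realType) l n k (x : R) : dyadic R l k x ->
  exists2 i, (i < 2 ^ n)%N & dyadic R (l + n) (k * 2 ^ n + i) x.
Proof.
move=> /andP[kx xk]; pose y := x * 2 ^+ (l + n).
have yE : y = x * 2 ^+ l * (2 ^ n)%:R by rewrite /y exprD mulrA natrX.
have p0 : 0 < (2 ^ n)%:R :> R by rewrite ltr0n expn_gt0.
have ky : (k * 2 ^ n)%:R <= y by rewrite yE natrM ler_pM2r.
have yk : y < (k.+1 * 2 ^ n)%:R by rewrite yE natrM ltr_pM2r.
have /Num.Theory.truncn_itv/andP[ty yt] : 0 <= y by apply: le_trans ky; rewrite ler0n.
set m := Num.trunc y in ty yt.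
have km : (k * 2 ^ n <= m)%N by rewrite -ltnS -(ltr_nat R); exact: le_lt_trans ky yt.
have mk : (m < k.+1 * 2 ^ n)%N by rewrite -(ltr_nat R); exact: le_lt_trans ty yk.
exists (m - k * 2 ^ n)%N; first by rewrite ltn_subLR// addnC -mulSn.
by rewrite subnKC//; apply/andP.
Qed.

Lemma dyadic_sub (R : realType) l n k i : (i < 2 ^ n)%N ->
  dyadic R (l + n) (k * 2 ^ n + i) `<=` dyadic R l k.
Proof.
move=> ilt x /andP[]; rewrite exprD mulrA => kx xk.
have p0 : 0 < (2 ^ n)%:R :> R by rewrite ltr0n expn_gt0.
apply/andP; split.
  rewrite -(ler_pM2r p0) natrX (le_trans _ kx)// -natrX -natrM ler_nat.
  exact: leq_addr.
rewrite -(ltr_pM2r p0) natrX (lt_le_trans xk)// -natrX -natrM ler_nat.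
by rewrite mulSn addnC ltn_add2r.
Qed.

Lemma dyadic_unit_lt (R : realType) l k :
  dyadic R l k `<=` dyadic R 0 0 -> (k < 2 ^ l)%N.
Proof.
move=> /(_ (k%:R / 2 ^+ l)) /=; rewrite /dyadic /= divfK ?expf_neq0//.
rewrite lexx ltr_nat ltnSn => /(_ isT)/andP[_].
by rewrite expr0 mulr1 ltr_pdivrMr ?exprn_gt0// mul1r -natrX ltr_nat.
Qed.

(** [B] is relative to the length [2^-l], so bounds pass from one level to a coarser one by
    averaging. Only intervals inside [W] count, as [missed] gives information only there. *)
Definition dyadic_density_le (R : realType) (W O : set R) (l : nat) (B : R) : Prop :=
  forall k, dyadic R l k `<=` W ->
    (lebesgue_measure (dyadic R l k `\` O) <= (B / 2 ^+ l)%:E)%E.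

Lemma measure_dyadic_split (R : realType) (O : set R) l n k : open O ->
  (lebesgue_measure (dyadic R l k `\` O) <=
   \sum_(i < 2 ^ n) lebesgue_measure (dyadic R (l + n) (k * 2 ^ n + i) `\` O))%E.
Proof.
move=> oO.
have mO : measurable (O : set (measurableTypeR R)) by
  exact: measurable_realfun.open_measurable.
pose D i : set (measurableTypeR R) := dyadic R (l + n) (k * 2 ^ n + i) `\` O.
have mD i : measurable (D i) by apply: measurableD => //; exact: measurable_dyadic.
rewrite -(big_mkord xpredT (fun i => lebesgue_measure (D i))).
apply: (le_trans _ (measure_bigcup_seq_le (@lebesgue_measure R) _ mD)).
apply: le_lebesgue.
- by apply: measurableD => //; exact: measurable_dyadic.
- exact: measurable_bigcup_seq.
- move=> x [/(dyadic_split n)[i ilt xi] nOx]; exists i => //=.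
  by rewrite mem_index_iota.
Qed.

Lemma dyadic_density_coarsen (R : realType) (W O : set R) l n B : open O ->
  dyadic_density_le W O (l + n) B -> dyadic_density_le W O l B.
Proof.
move=> oO densB k kW; apply: le_trans (measure_dyadic_split l n k oO) _.
apply: (@le_trans _ _ (\sum_(i < 2 ^ n) (B / 2 ^+ (l + n))%:E)%E).
  by apply: lee_sum => i _; apply: densB; apply: subset_trans kW; exact: dyadic_sub.
rewrite sumEFin lee_fin big_const_ord iter_addr addr0 -[leLHS]mulr_natr natrX.
by rewrite exprD invfM mulrA mulfVK ?expf_neq0.
Qed.

(** One of the [2 ^ n] subintervals contributes nothing to the average. *)
Lemma dyadic_density_hole (R : realType) (W O : set R) l n B : open O ->
  (forall k, dyadic R l k `<=` W ->
    lebesgue_measure (dyadic R (l + n) (k * 2 ^ n) `\` O) = 0%E) ->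
  dyadic_density_le W O (l + n) B ->
  dyadic_density_le W O l (B * (1 - (2 ^+ n)^-1)).
Proof.
move=> oO hole densB k kW; apply: le_trans (measure_dyadic_split l n k oO) _.
have p0 : (0 < 2 ^ n)%N by rewrite expn_gt0.
rewrite (bigD1 (Ordinal p0))//= addn0 hole// add0e.
apply: (@le_trans _ _ (\sum_(i < 2 ^ n | i != Ordinal p0) (B / 2 ^+ (l + n))%:E)%E).
  apply: lee_sum => i _; apply: densB; apply: subset_trans kW; exact: dyadic_sub.
rewrite sumEFin lee_fin sumr_const cardC1 card_ord -[leLHS]mulr_natr.
rewrite -subn1 natrB// natrX exprD.
have : 2 ^+ n != 0 :> R by rewrite expf_neq0.
have : 2 ^+ l != 0 :> R by rewrite expf_neq0.
move: (2 ^+ n) (2 ^+ l) => x y y0 x0.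
by rewrite le_eqVlt; apply/orP; left; apply/eqP; field; rewrite x0 y0.
Qed.

(* For [n > 0], the reals of [[0, 1]] having a binary expansion whose digits of ranks
   [n * m, ..., n * m + n - 1] are all [0]; for distinct [m] they are independent of
   measure [2^-n]. *)
Definition block (R : realType) (n m : nat) : set R :=
  \bigcup_(k in `I_(2 ^ (n * m)))
    [set x | (k * 2 ^ n)%:R <= x * 2 ^+ (n * m + n) <= (k * 2 ^ n).+1%:R].
Arguments block : clear implicits.

Definition block_limsup (R : realType) (f : nat -> nat) : set R :=
  lim_sup_set (fun n => block R n.+1 (f n)).
Arguments block_limsup : clear implicits.

(** Distinct [m] concern disjoint ranges of digits: going up from the finest level, each [m] in [s]
    contributes a factor [1 - 2^-n], and between the ranges the bound is averaged. *)
Lemma dyadic_density_blocks (R : realType) (W O : set R) n (s : seq nat) l :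
  open O -> sorted ltn s -> (forall m, m \in s -> (l <= n * m)%N) ->
  (forall m k, m \in s -> dyadic R (n * m) k `<=` W ->
    lebesgue_measure (dyadic R (n * m + n) (k * 2 ^ n) `\` O) = 0%E) ->
  dyadic_density_le W O l ((1 - (2 ^+ n)^-1) ^+ size s).
Proof.
move=> oO; elim: s l => [|m s IH] l.
  move=> _ _ _ k _; rewrite expr0 mul1r -(lebesgue_dyadic R l k).
  have mO : measurable (O : set (measurableTypeR R)) by
  exact: measurable_realfun.open_measurable.
  apply: le_lebesgue; [|exact: measurable_dyadic|exact: subIsetl].
  by apply: measurableD => //; exact: measurable_dyadic.
rewrite /= (path_sortedE ltn_trans) => /andP[/allP ms sorted_s] ls hole.
apply: (@dyadic_density_coarsen _ _ _ _ (n * m - l)) => //.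
rewrite subnKC ?ls ?mem_head//.
rewrite exprSr; apply: dyadic_density_hole => //.
  by move=> k; apply: hole; rewrite mem_head.
apply: IH => // [m' m's|m' k m's]; last by apply: hole; rewrite inE m's orbT.
by rewrite addnC -mulnS leq_mul2l ms ?orbT.
Qed.

Lemma block_itv (R : realType) (l k : nat) :
  [set x : R | k%:R <= x * 2 ^+ l <= k.+1%:R] =
  [set` `[k%:R / 2 ^+ l, k.+1%:R / 2 ^+ l]].
Proof.
apply/seteqP; split=> x /=; rewrite in_itv /= ler_pdivrMr ?exprn_gt0//;
  by rewrite ler_pdivlMr ?exprn_gt0.
Qed.

Lemma block_seq (R : realType) n m : block R n m =
  \bigcup_(k in [set` iota 0 (2 ^ (n * m))])
    [set` `[(k * 2 ^ n)%:R / 2 ^+ (n * m + n),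
            (k * 2 ^ n).+1%:R / 2 ^+ (n * m + n)]].
Proof.
rewrite /block; under eq_bigcupr do rewrite block_itv.
by congr bigcup; apply/seteqP; split=> k /=; rewrite mem_iota.
Qed.

Lemma measurable_block (R : realType) n m :
  measurable (block R n m : set (measurableTypeR R)).
Proof. by rewrite block_seq; apply: measurable_bigcup_seq. Qed.

Lemma lebesgue_block_le (R : realType) n m :
  (lebesgue_measure (block R n m) <= ((2 ^+ n)^-1)%:E)%E.
Proof.
rewrite block_seq; pose D k : set (measurableTypeR R) :=
  [set` `[(k * 2 ^ n)%:R / 2 ^+ (n * m + n), (k * 2 ^ n).+1%:R / 2 ^+ (n * m + n)]].
have mD k : measurable (D k) by exact: measurable_itv.
apply: (le_trans (measure_bigcup_seq_le (@lebesgue_measure R) _ mD)).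
have D_le k : (lebesgue_measure (D k) <= ((2 ^+ (n * m + n))^-1)%:E)%E.
  rewrite lebesgue_measure_itv /= lte_fin ltr_pM2r ?invr_gt0 ?exprn_gt0//.
  by rewrite ltr_nat ltnSn -EFinB -mulrBl -natrB// subSnn mul1r.
apply: (@le_trans _ _
    (\sum_(k <- iota 0 (2 ^ (n * m))) ((2 ^+ (n * m + n))^-1)%:E)%E).
  by apply: lee_sum => k _; exact: D_le.
rewrite sumEFin lee_fin big_const_seq count_predT size_iota iter_addr addr0.
by rewrite -[leLHS]mulr_natr natrX exprD invfM mulrAC mulVf ?mul1r ?expf_neq0.
Qed.

(** Borel-Cantelli: the measures are at most [2^-(n+1)], hence summable. *)
Lemma null_block_limsup (R : realType) f : lebesgue_null (block_limsup R f).
Proof.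
have mB n : measurable (block R n.+1 (f n) : set (measurableTypeR R)).
  exact: measurable_block.
apply/negligibleP.
  apply: bigcapT_measurable => n; apply: bigcup_measurable => k _; exact: mB.
apply: lim_sup_set_cvg0 => //; apply: (@le_lt_trans _ _ 1%E); last exact: ltry.
apply: le_trans (epsilon_trick0 xpredT ler01).
apply: lee_nneseries => // n _; rewrite div1r natrX.
exact: lebesgue_block_le.
Qed.

(** A list of distinct elements of [A] of maximal length exhausts [A]. *)
Lemma cover_of_bounded_uniq (A : set nat) r :
  (forall s, uniq s -> [set` s] `<=` A -> (size s <= r)%N) ->
  exists2 s : seq nat, (size s <= r)%N & A `<=` [set` s].
Proof.
move=> bnd;
pose P i :=
  `[< exists s : seq nat, [/\ uniq s, [set` s] `<=` A & size s = i] >].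
have exP : exists i, P i by exists 0%N; apply/asboolP; exists [::].
have ubP i : P i -> (i <= r)%N by move=> /asboolP[s [us sA <-]]; exact: bnd.
have [i /asboolP[s [us sA <-]] maxi] := ex_maxnP exP ubP.
exists s; first exact: bnd.
move=> x Ax; apply: contrapT => /negP xs.
have /maxi : P (size s).+1.
  apply/asboolP; exists (x :: s); split=> //=; first by rewrite xs.
  by move=> y /=; rewrite inE => /predU1P[->|/sA].
by rewrite ltnn.
Qed.

(* The indices [m >= n] of the blocks of order [n] missed by the part of
   [W \ O] that carries the measure. *)
Definition missed (R : realType) (O W : set R) (n : nat) : set nat :=
  [set m | (n <= m)%N /\ forall k, dyadic R (n * m) k `<=` W ->
     lebesgue_measure (dyadic R (n * m + n) (k * 2 ^ n) `\` O) = 0%E].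

Lemma size_missed (R : realType) (O : set R) (r : nat -> nat) l k :
  open O -> (forall n, ((1 - (2 ^+ n.+1)^-1) ^+ r n <= (2 ^+ n)^-1 :> R)) ->
  (0 < lebesgue_measure (dyadic R l k `\` O))%E ->
  \forall n \near \oo, forall s, uniq s ->
    [set` s] `<=` missed O (dyadic R l k) n.+1 -> (size s <= r n)%N.
Proof.
move=> oO rP pos.
have mO : measurable (O : set (measurableTypeR R)) by
  exact: measurable_realfun.open_measurable.
have mD : measurable (dyadic R l k `\` O : set (measurableTypeR R)).
  by apply: measurableD => //; exact: measurable_dyadic.
have fin : lebesgue_measure (dyadic R l k `\` O) \is a fin_num.
  rewrite ge0_fin_numE//; apply: (@le_lt_trans _ _ (2 ^- l)%:E); last exact: ltry.
  rewrite -(lebesgue_dyadic R l k); apply: le_lebesgue => //; exact: measurable_dyadic.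
move: pos; rewrite -(fineK fin) lte_fin; set c := fine _ => c0.
have small : \forall n \near \oo, (2 ^+ n)^-1 < c * 2 ^+ l.
  by apply: near_exp2V_lt; rewrite mulr_gt0 ?exprn_gt0.
near=> n => s us sA; rewrite leqNgt; apply/negP => rs.
(* Missed indices are at least [n.+1], hence positive, so for [l <= n] their digits come after those
   fixed by the interval. *)
have ln : (l <= n)%N by near: n; exact: nbhs_infty_ge.
have : dyadic_density_le (dyadic R l k) O l
    ((1 - (2 ^+ n.+1)^-1) ^+ size (sort leq s)).
  apply: dyadic_density_blocks => //.
  - rewrite ltn_sorted_uniq_leq sort_uniq us sort_sorted//; exact: leq_total.
  - move=> m; rewrite mem_sort => /sA[nm _].
    by rewrite (leq_trans ln)// (leq_trans (leqnSn n))// leq_pmulr// (leq_trans _ nm).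
  - by move=> m k'; rewrite mem_sort => /sA[_]; apply.
move=> /(_ k (@subset_refl _ _)); rewrite size_sort.
apply/negP; rewrite -ltNge -(fineK fin) lte_fin -/c ltr_pdivrMr ?exprn_gt0//.
apply: le_lt_trans (_ : (2 ^+ n)^-1 < _); last by near: n.
apply: le_trans (rP n).
have x1 : (2 ^+ n.+1)^-1 <= 1 :> R.
  by rewrite invf_le1 ?exprn_gt0// exprn_ege1// ler1n.
apply: ler_wiXn2l; last exact: ltnW.
  by rewrite subr_ge0.
by rewrite gerBl invr_ge0 exprn_ge0.
Unshelve. all: by end_near.
Qed.

(* Baire category in the set of reals all of whose dyadic neighbourhoods meet the
   complement of [O] in positive measure. *)
Lemma missed_of_block_limsup (R : realType) (O : set R) (f : nat -> nat) :
  open O -> block_limsup R f `<=` O ->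
  (0 < lebesgue_measure (dyadic R 0 0 `\` O))%E ->
  exists l k N, (0 < lebesgue_measure (dyadic R l k `\` O))%E /\
    forall n, (N <= n)%N -> (n.+1 <= f n)%N ->
      missed O (dyadic R l k) n.+1 (f n).
Proof.
move=> oO fO pos0; apply: contrapT => noW.
pose D (p : nat * nat) : set R := dyadic R p.1 p.2.
(* For [q = (n, k)], the leftmost subinterval, which has the zeros required by the block of order
   [n.+1] and index [f n]. *)
pose next (q : nat * nat) := (q.1.+1 * f q.1 + q.1.+1, q.2 * 2 ^ q.1.+1)%N.
pose pos p := D p `<=` D (0, 0)%N /\ (0 < lebesgue_measure (D p `\` O))%E.
have /choice[step stepP] : forall ip : nat * (nat * nat), exists q : nat * nat,
    pos ip.2 -> [/\ (ip.1 <= q.1)%N, D (q.1.+1 * f q.1, q.2)%N `<=` D ip.2 &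
      (0 < lebesgue_measure (D (next q) `\` O))%E].
  move=> [i p]; have [[pU pp]|npos] := pselect (pos p); last by exists (0, 0)%N.
  apply: contrapT => noq; apply: noW; exists p.1, p.2, i; split=> // n ni nf.
  split=> // k kp; apply/eqP; rewrite eq_le measure_ge0 andbT leNgt.
  by apply/negP => knull; apply: noq; exists (n, k) => _; split.
(* Step [i] treats a place at least [i], so the nested intervals meet the blocks of infinitely many
   orders. *)
pose node := fix node i := if i is j.+1 then next (step (j, node j)) else (0, 0)%N.
have D_next q : D (next q) `<=` D (q.1.+1 * f q.1, q.2)%N.
  by rewrite /D /next /= -[X in dyadic R _ X]addn0; apply: dyadic_sub; rewrite expn_gt0.
have pos_node i : pos (node i).
  elim: i => [|i IH]; first by split.
  have [_ sub posq] := stepP (i, node i) IH; split=> //=.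
  by apply: subset_trans (D_next _) _; apply: subset_trans sub IH.1.
have nodeS i : D (node i.+1) `<=` D (node i).
  by have [_ sub _] := stepP (i, node i) (pos_node i); exact: subset_trans (D_next _) sub.
have node_le i j : (i <= j)%N -> D (node j) `<=` D (node i).
  move=> /subnKC <-; elim: (j - i)%N => [|d IH]; first by rewrite addn0.
  by rewrite addnS; apply: subset_trans (nodeS _) IH.
pose left p : R := p.2%:R / 2 ^+ p.1.
have p2 l : 0 < 2 ^+ l :> R by rewrite exprn_gt0.
have leftD p : D p (left p).
  by rewrite /D /dyadic /left /= divfK ?gt_eqF// lexx ltr_nat ltnSn.
have left_le i j : left (node j) <= (node i).2.+1%:R / 2 ^+ (node i).1.
  have /(node_le _ _ (leq_maxr i j))/andP[lj _] := leftD (node (maxn i j)).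
  have /(node_le _ _ (leq_maxl i j))/andP[_ /ltW li] := leftD (node (maxn i j)).
  apply: (@le_trans _ _ (left (node (maxn i j)))); last by rewrite ler_pdivlMr.
  by rewrite {1}/left ler_pdivrMr.
(* This supremum may be a right endpoint, so it is located only in the closures of the nodes; this
   is why blocks consist of closed intervals. *)
pose x := sup (range (left \o node)).
have x_node i : (node i).2%:R <= x * 2 ^+ (node i).1 <= (node i).2.+1%:R.
  apply/andP; split.
    rewrite -ler_pdivrMr//.
    have ub : has_ubound (range (left \o node)).
      by exists ((node i).2.+1%:R / 2 ^+ (node i).1) => _ [j _ <-]; exact: left_le.
    by apply: (ub_le_sup ub); exists i.
  rewrite -ler_pdivlMr//; apply: ge_sup; first by exists (left (node 0%N)); exists 0%N.
  by move=> _ [j _ <-]; exact: left_le.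
have Ox : O x.
  apply: fO => N _; have [Nq sub _] := stepP (N, node N) (pos_node N).
  exists (step (N, node N)).1 => //; exists (step (N, node N)).2.
    by apply: (@dyadic_unit_lt R); apply: subset_trans sub (pos_node N).1.
  exact: (x_node N.+1).
(* A ball around [x] inside [O] contains a whole node, against the positive measure of nodes outside
   [O]. *)
have /nbhs_ballP[e /= e0 xeO] : nbhs x O by apply: open_nbhs_nbhs; split.
have [i ie] : exists i, (2 ^+ i)^-1 < e.
  by have [i _ /(_ i (leqnn i))] := near_exp2V_lt e0; exists i.
have [_] := pos_node i.+1.
suff -> : D (node i.+1) `\` O = set0 by rewrite measure0 ltxx.
apply/seteqP; split=> // y [/andP[ky yk]]; apply; apply: xeO.
have /andP[kx xk] := x_node i.+1.
have le_i : (i <= (node i.+1).1)%N.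
  have [iq _ _] := stepP (i, node i) (pos_node i).
  by rewrite /= (leq_trans iq)// (leq_trans (leqnSn _))// leq_addl.
rewrite /ball /=; apply: le_lt_trans ie.
apply: (@le_trans _ _ (2 ^+ (node i.+1).1)^-1); last first.
  by rewrite lef_pV2 ?posrE// ler_weXn2l// ler1n.
rewrite -[leRHS]mul1r ler_pdivlMr// -[X in _ * X]gtr0_norm// -normrM mulrBl ler_norml.
move: ky yk kx xk; set l := (node i.+1).1; rewrite -natr1.
by move=> *; apply/andP; split; lra.
Qed.

Lemma localized_of_null (R : realType) : exists h, forall F : set (nat -> nat),
  lebesgue_null (\bigcup_(f in F) block_limsup R f) -> localized h F.
Proof.
have /choice[r rP] : forall n, exists r,
    (1 - (2 ^+ n.+1)^-1) ^+ r <= (2 ^+ n)^-1 :> R.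
  move=> n; set z : R := 1 - _.
  have : z ^+ i @[i --> \oo] --> (0 : R).
    apply: cvg_expr; rewrite ger0_norm; first by rewrite gtrBl invr_gt0 exprn_gt0.
    by rewrite subr_ge0 invf_le1 ?exprn_gt0// exprn_ege1// ler1n.
  move=> /cvgr_lt/(_ (2 ^+ n)^-1); rewrite invr_gt0 exprn_gt0// => /(_ isT).
  by move=> [i _ /(_ i (leqnn i))] ?; exists i; exact: ltW.
(* The term [n.+1] is for the values [f n <= n], which [missed] excludes; the product is for the
   first [n.+1] dyadic pieces, with at most [r n] indices each. *)
exists (fun n => n.+1 + n.+1 * r n)%N => F /(lebesgue_null_open ltr01)[ O [oO FO O1]].
have mO : measurable (O : set (measurableTypeR R)) by
  exact: measurable_realfun.open_measurable.
have pos0 : (0 < lebesgue_measure (dyadic R 0 0 `\` O))%E.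
  rewrite ltNge; apply/negP => D0; move: O1; apply/negP; rewrite -leNgt.
  have -> : 1%:E = lebesgue_measure (dyadic R 0 0) by rewrite lebesgue_dyadic invr1.
  have mD : measurable (dyadic R 0 0 `\` O : set (measurableTypeR R)).
    by apply: measurableD => //; exact: measurable_dyadic.
  apply: (@le_trans _ _ (lebesgue_measure ((dyadic R 0 0 `\` O) `|` O))).
    apply: le_lebesgue; [exact: measurable_dyadic|exact: measurableU|].
    by move=> y Dy; have [Oy|nOy] := pselect (O y); [right|left].
  by apply: (le_trans (measureU2 _ _ _)) => //; rewrite -[leRHS]add0e leeD2r.
(* A missed set without the size bound gets an arbitrary short list; for a piece of positive measure
   outside [O], [size_missed] excludes this case at large [n]. *)
have /choice[T TP] : forall pn : (nat * nat) * nat, exists s : seq nat,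
    (size s <= r pn.2)%N /\ ((forall t, uniq t ->
      [set` t] `<=` missed O (dyadic R pn.1.1 pn.1.2) pn.2.+1 ->
      (size t <= r pn.2)%N) ->
    missed O (dyadic R pn.1.1 pn.1.2) pn.2.+1 `<=` [set` s]).
  move=> [p n] /=; set A := missed _ _ _.
  have [bnd|nbnd] := pselect (forall t, uniq t -> [set` t] `<=` A -> (size t <= r n)%N).
    by have [s ? ?] := cover_of_bounded_uniq bnd; exists s.
  by exists [::].
pose T' n i := if unpickle i is Some p then T (p, n) else [::].
exists (fun n => iota 0 n.+1 ++ flatten [seq T' n i | i <- iota 0 n.+1]).
  move=> n; rewrite size_cat size_iota leq_add2l size_flatten /shape -map_comp.
  rewrite sumnE big_map; apply: (@leq_trans (\sum_(i <- iota 0 n.+1) r n)%N).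
    apply: leq_sum => i _ /=; rewrite /T'; case: unpickle => [p|//].
    by have [] := TP (p, n).
  by rewrite big_const_seq count_predT size_iota iter_addn_0 mulnC.
move=> f Ff.
have fO : block_limsup R f `<=` O by apply: subset_trans FO; exact: bigcup_sup.
have [l [k [N [pos fN]]]] := missed_of_block_limsup oO fO pos0.
have bnd := size_missed oO rP pos.
near=> n; rewrite mem_cat mem_iota add0n ltnS leq0n andTb.
have [//|nf] := leqP (f n) n.
apply/flatten_mapP; exists (pickle (l, k)).
  by rewrite mem_iota add0n ltnS /=; near: n; exact: nbhs_infty_ge.
rewrite /T' pickleK; have [_ /= T_sub] := TP ((l, k), n).
apply: T_sub; first by near: n.
by apply: fN => //; near: n; exact: nbhs_infty_ge.
Unshelve. all: by end_near.
Qed.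

(** * The equality of cardinals *)

Lemma setT_not_null (R : realType) : ~ lebesgue_null [set: R].
Proof.
move=> nullT; have : lebesgue_null (dyadic R 0 0).
  exact: negligibleS (@subsetT _ _) nullT.
move=> /(measure_negligible (@measurable_dyadic R 0 0)).
rewrite -[LHS]/(lebesgue_measure (dyadic R 0 0)).
by rewrite lebesgue_dyadic invr1 => -[] /eqP; rewrite oner_eq0.
Qed.

Local Close Scope ring_scope.

Theorem theorem6p6 (R : realType) :
  add_null R #= min_card non_rapid_raisonnier bounding_number.
Proof.
have [h locF] := localized_of_null R.
(* The singletons are null and cover the line, so [least_cardP] applies to [add_null]. *)
have [] : [set F : set (set R) | F `<=` @lebesgue_null R /\
    ~ lebesgue_null (\bigcup_(A in F) A)] !=set0.
  exists (range set1); split=> [_ [x _ <-]|].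
    by apply/negligibleP => //; exact: lebesgue_measure_set1.
  have -> : \bigcup_(A in range set1) A = [set: R].
    by apply/seteqP; split=> // x _; exists [set x] => //; exists x.
  exact: setT_not_null.
move=> A0 C0; have [] := least_cardP (ex_intro _ A0 C0).
rewrite -/(add_null R) => -[addN add_nnull] add_min {A0 C0}.
have [nonR non_min] := least_cardP exists_non_rapid.
have [unb unb_min] := least_cardP exists_unbounded.
rewrite -/non_rapid_raisonnier in nonR non_min.
rewrite -/bounding_number in unb unb_min.
(* The sets [block_limsup R f] of an uncaptured family are null with a non-null union. *)
have add_le (F : set (nat -> nat)) : ~ localized h F -> add_null R #<= F.
  move=> nloc; apply: card_le_trans (card_image_le (block_limsup R) F).
  apply: add_min; split=> [_ [f _ <-]|]; first exact: null_block_limsup.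
  by rewrite bigcup_image => /locF.
rewrite card_eq_le; apply/andP; split.
  apply: le_min_card.
    have [k kincr nloc] : exists2 k, {homo k : m n / (m < n)%N} &
        ~ localized h (restriction_code k @` non_rapid_raisonnier).
      apply: contrapT => nok; apply: nonR; apply: (@rapid_of_localized h) => k kincr.
      by apply: contrapT => nloc; apply: nok; exists k.
    exact: card_le_trans (add_le _ nloc) (card_image_le _ _).
  by apply: add_le => /localized_bounded.
(* If neither cardinal were at most [add_null], each image of [add_null] would be bounded with its
   graphs forming a rapid set, hence captured, and the union of [add_null] would be null. *)
apply/min_card_le; apply: contrapT => /not_orP[non_gt unb_gt].
apply: add_nnull; apply: null_bigcup_of_localized => // g.
have [G GP] : exists G, forall f, (g @` add_null R) f -> eventually_le f G.
  apply: contrapT => /unb_min le; apply: unb_gt.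
  exact: card_le_trans le (card_image_le _ _).
apply: localized_of_rapid GP _; apply: contrapT => /non_min le; apply: non_gt.
apply: card_le_trans le _.
exact: card_le_trans (card_image_le _ _) (card_image_le _ _).
Qed.
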